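(* Let $\varepsilon>0$, let $H\in C^2(\mathbb{R})$ be strictly convex and let $g\in C^1((0,\infty))$ be strictly increasing. Let $P\in C^2((0,\infty))$ satisfy $P''(m)=\frac{g'(m)}{m}$ for all $m>0$. Suppose that $C_H<\infty$ and $C_P<\infty$. Let $v,m\in C^2(\mathbb{T}\times(0,+\infty))\cap C(\mathbb{T}\times[0,+\infty))$, with $m>0$, solve $$\begin{cases} v_t+(H(v)-g(m))_x=\varepsilon v_{xx},\\ m_t-(mH'(v))_x=\varepsilon m_{xx},\end{cases}\qquad (x,t)\in\mathbb{T}\times(0,\infty),$$ and satisfy $$\int_{\mathbb{T}} v(x,0)\,dx=0,\qquad \int_{\mathbb{T}} m(x,0)\,dx=1.$$ Then $$\lim_{t\to\infty}\int_{\mathbb{T}}|v(x,t)|\,dx=0,\qquad \lim_{t\to\infty}\int_{\mathbb{T}}|m(x,t)-1|\,dx=0.$$ Moreover, if $$\sup_{t\ge 0}\|v(\cdot,t)\|_{C(\mathbb{T})}<\infty\quad\text{and}\quad \sup_{t\ge0}\|m(\cdot,t)\|_{C(\mathbb{T})}<\infty,$$ then, for all $1<p<\infty$, $$\lim_{t\to\infty}\int_{\mathbb{T}}|v(x,t)|^p\,dx=0\quad\text{and}\quad \lim_{t\to\infty}\int_{\mathbb{T}}|m(x,t)-1|^p\,dx=0.$$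
   Context: $\mathbb{T}$ is the one-dimensional torus, identified with $[0,1]$ (functions on $\mathbb{T}$ are 1-periodic), so it has total length $1$. $\|\cdot\|_{C(\mathbb{T})}$ is the sup norm. The functions $v,m$ are real-valued. For an open interval $I\subset\mathbb{R}$ and a strictly convex $\Phi\in C^2(I)$, let $\Psi\in C^1(I)$ be any function with $\Psi'(s)=\sqrt{\Phi''(s)}$ for $s\in I$, and set, for $a,b\in I$, $a\neq b$, $$C_\Phi(a,b)=\frac{\Phi(a)+\Phi(b)-2\Phi\left(\frac{a+b}{2}\right)}{(\Psi(b)-\Psi(a))^2},\qquad C_\Phi=\sup_{a,b\in I,\ a\ne b} C_\Phi(a,b)\in[0,\infty].$$ Here $C_H$ is taken with $\Phi=H$, $I=\mathbb{R}$, and $C_P$ with $\Phi=P$, $I=(0,\infty)$. The function $P$ is determined only up to adding an affine function, which does not affect $C_P$; $P$ is strictly convex because $g$ is strictly increasing. *)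

(* Defs.v *)
From Stdlib Require Import Reals.
From Coquelicot Require Import Coquelicot.
Open Scope R_scope.

(* Open intervals are represented by their characteristic predicates. *)
Definition whole_line : R -> Prop := fun _ => True.
Definition pos_half_line : R -> Prop := fun s => 0 < s.

(* f is of class C^n on the open set I; f is unconstrained outside I. *)
Definition C_class (n : nat) (I : R -> Prop) (f : R -> R) : Prop :=
  forall k : nat, (k <= n)%nat -> forall s : R, I s ->
    ex_derive_n f k s /\ continuous (Derive_n f k) s.

Definition strictly_increasing_on (I : R -> Prop) (f : R -> R) : Prop :=
  forall a b : R, I a -> I b -> a < b -> f a < f b.

Definition strictly_convex_on (I : R -> Prop) (f : R -> R) : Prop :=
  forall a b lambda : R, I a -> I b -> a <> b -> 0 < lambda < 1 ->
    f (lambda * a + (1 - lambda) * b) < lambda * f a + (1 - lambda) * f b.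

Definition sqrt_second_primitive (I : R -> Prop) (Phi Psi : R -> R) : Prop :=
  C_class 1 I Psi /\
  forall s : R, I s -> Derive Psi s = sqrt (Derive_n Phi 2 s).

Definition convexity_ratio (Phi Psi : R -> R) (a b : R) : R :=
  (Phi a + Phi b - 2 * Phi ((a + b) / 2)) / (Psi b - Psi a) ^ 2.

(* For strictly convex Phi, the value depends neither on the choice of Psi with
   [sqrt_second_primitive I Phi Psi] (unique up to a constant) nor on adding an
   affine function to Phi; Psi is then injective on I, so no denominator
   vanishes. *)
Definition convexity_const (I : R -> Prop) (Phi Psi : R -> R) : Rbar :=
  Lub_Rbar (fun r => exists a b : R,
    I a /\ I b /\ a <> b /\ r = convexity_ratio Phi Psi a b).

(* A function on T x [0, +oo) is a function u : R -> R -> R, written u x t,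
   1-periodic in x for t >= 0; its values at t < 0 are irrelevant. *)
Definition periodic_in_space (u : R -> R -> R) : Prop :=
  forall x t : R, 0 <= t -> u (x + 1) t = u x t.

(* u belongs to C^2(T x (0, +oo)) and C(T x [0, +oo)); continuity at t = 0 is
   relative to the closed half-plane. *)
Definition classical_regularity (u : R -> R -> R) : Prop :=
  periodic_in_space u /\
  (forall x t : R, 0 < t -> ex_diff_n u 2 x t) /\
  continuous_on (fun z : R * R => 0 <= snd z)
                (fun z : R * R => u (fst z) (snd z)).

Definition d_t (u : R -> R -> R) (x t : R) : R := Derive (fun s => u x s) t.
Definition d_x (u : R -> R -> R) (x t : R) : R := Derive (fun y => u y t) x.
Definition d_xx (u : R -> R -> R) (x t : R) : R := d_x (d_x u) x t.

Definition solves_system (eps : R) (H g : R -> R) (v m : R -> R -> R) : Prop :=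
  forall x t : R, 0 < t ->
    d_t v x t + d_x (fun y s => H (v y s) - g (m y s)) x t
      = eps * d_xx v x t /\
    d_t m x t - d_x (fun y s => m y s * Derive H (v y s)) x t
      = eps * d_xx m x t.

(* On 1-periodic functions this is integration over the torus. *)
Definition torus_int (f : R -> R) : R := RInt f 0 1.

Definition sup_norm (f : R -> R) : Rbar :=
  Lub_Rbar (fun r => exists x : R, r = Rabs (f x)).

Definition uniformly_bounded_in_time (u : R -> R -> R) : Prop :=
  exists M : R, forall t : R, 0 <= t -> Rbar_le (sup_norm (fun x => u x t)) M.

(* |y|^p for p > 0.  The case y = 0 is separate because ln 0 = 0 in Stdlib,
   so that Rpower 0 p = 1. *)
Definition abs_power (y p : R) : R :=
  if Req_EM_T y 0 then 0 else Rpower (Rabs y) p.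

(* Main.v *)
Require Import Defs.
From Stdlib Require Import Reals Lra Classical.
From Coquelicot Require Import Coquelicot.
Open Scope R_scope.

(** The convex entropy [H(v) + P(m)] is a Lyapunov functional.  The relation
    [m P''(m) = g'(m)] makes it compatible with the first-order part of the
    system, whose contribution is a perfect [x]-derivative and integrates to zero
    over the torus; the viscosity then gives
      [d/dt int (H(v) + P(m)) = - eps int (H''(v) v_x^2 + P''(m) m_x^2)]
    ([entropy_production_identity], [is_derive_entropy]).  Both equations are in
    divergence form, so the means of [v] and [m] stay equal to [0] and [1]
    ([mean_conserved]), and up to the constant [H(0) + P(1)] the entropy is the
    integral of the relative entropies of [v] with respect to [0] and of [m]
    with respect to [1] ([entropy_decomposition]); these are nonnegative.

    The entropy is thus bounded below and nonincreasing, so its dissipation is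
    arbitrarily small at some times ([dissipation_small_sometime]).  Since
    [H''(v) v_x^2] is the square of the [x]-derivative of [PsiH(v)], at such a time
    [PsiH(v)] hardly oscillates on the torus; [v] attains its mean, and [PsiH] is
    strictly increasing, so [v] is uniformly close to [0].  In the same way [m] is
    uniformly close to [1], and the relative entropies are small
    ([small_dissipation_small_relative_entropy]).  By monotonicity they remain
    small at all later times ([relative_entropies_vanish]).

    A strictly convex relative entropy grows at least linearly away from its
    minimum, hence controls the distance in [L^1]
    ([relative_entropy_controls_L1]).  Under uniform bounds the convergence
    in [L^p] follows from [|y|^p <= M^(p-1) |y|] for [|y| <= M]
    ([bounded_L1_limit_Lp_limit]).

    The equations are used only for [t > 0], where the solution is smooth and
    [m > 0]; the initial condition enters through the continuity at [t = 0] of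
    the two means. *)

(** * Functions with a derivative that vanishes on no interval *)

Definition order_convex (I : R -> Prop) : Prop :=
  forall a b s : R, I a -> I b -> a <= s <= b -> I s.

(** Applied to [Phi''] this expresses strict convexity of [Phi] in a form that also
    allows isolated zeros of [Phi''] and passes to its square root. *)
Definition nonneg_nowhere_flat (I : R -> Prop) (f : R -> R) : Prop :=
  (forall s, I s -> 0 <= f s) /\
  (forall a b, I a -> I b -> a < b -> exists s, a < s < b /\ f s <> 0).

Lemma order_convex_whole_line : order_convex whole_line.
Proof. intros a b s _ _ _; exact I. Qed.

Lemma order_convex_pos_half_line : order_convex pos_half_line.
Proof. unfold order_convex, pos_half_line; intros; lra. Qed.

Lemma is_derive_continuity_pt (f : R -> R) (x l : R) :
  is_derive f x l -> continuity_pt f x.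
Proof.
  intros Hf; apply continuity_pt_filterlim.
  apply (ex_derive_continuous f x); exists l; exact Hf.
Qed.

Lemma MVT_on (I : R -> Prop) (f df : R -> R) (a b : R) :
  order_convex I -> (forall s, I s -> is_derive f s (df s)) ->
  I a -> I b -> a <= b ->
  exists c, a <= c <= b /\ I c /\ f b - f a = df c * (b - a).
Proof.
  intros HI Hd Ia Ib Hab.
  assert (Hin : forall s, a <= s <= b -> I s)
    by (intros s Hs; exact (HI a b s Ia Ib Hs)).
  destruct (MVT_gen f a b df) as [c [Hc Heq]].
  - rewrite Rmin_left, Rmax_right by lra; intros x Hx; apply Hd, Hin; lra.
  - rewrite Rmin_left, Rmax_right by lra; intros x Hx.
    apply (is_derive_continuity_pt f x (df x)), Hd, Hin; lra.
  - rewrite Rmin_left, Rmax_right in Hc by lra.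
    exists c; repeat split; try tauto; apply Hin; tauto.
Qed.

Lemma nondecreasing_of_derive (I : R -> Prop) (f df : R -> R) (a b : R) :
  order_convex I -> (forall s, I s -> is_derive f s (df s)) ->
  (forall s, I s -> 0 <= df s) -> I a -> I b -> a <= b -> f a <= f b.
Proof.
  intros HI Hd Hpos Ia Ib Hab.
  destruct (MVT_on I f df a b HI Hd Ia Ib Hab) as [c [_ [Ic Heq]]].
  specialize (Hpos c Ic); nra.
Qed.

Lemma derive_zero_of_locally_constant (f : R -> R) (a b s l : R) :
  (forall x, a < x < b -> f x = f s) -> a < s < b -> is_derive f s l -> l = 0.
Proof.
  intros Hc Hs Hl.
  apply (is_derive_unique f s l) in Hl; rewrite <- Hl.
  rewrite (Derive_ext_loc f (fun _ => f s) s); [apply Derive_const|].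
  assert (Hd : 0 < Rmin (s - a) (b - s)) by (apply Rmin_pos; lra).
  exists (mkposreal _ Hd); intros y Hy; apply Hc.
  assert (Hy' : Rabs (y - s) < Rmin (s - a) (b - s)) by exact Hy.
  pose proof (Rmin_l (s - a) (b - s)); pose proof (Rmin_r (s - a) (b - s)).
  apply Rabs_def2 in Hy'; lra.
Qed.

(** If [f a = f b], the nondecreasing function [f] is constant between [a] and
    [b], so its derivative vanishes there. *)
Lemma strictly_increasing_of_derive (I : R -> Prop) (f df : R -> R) :
  order_convex I -> (forall s, I s -> is_derive f s (df s)) ->
  nonneg_nowhere_flat I df -> strictly_increasing_on I f.
Proof.
  intros HI Hd [Hpos Hflat] a b Ia Ib Hab.
  assert (Hmon : forall x y, I x -> I y -> x <= y -> f x <= f y)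
    by (intros x y Ix Iy Hxy; eapply nondecreasing_of_derive; eauto).
  assert (Hin : forall s, a <= s <= b -> I s)
    by (intros s Hs; exact (HI a b s Ia Ib Hs)).
  destruct (Rle_lt_or_eq_dec (f a) (f b)) as [Hlt|Heq]; [|exact Hlt|].
  { apply Hmon; auto; lra. }
  exfalso; destruct (Hflat a b Ia Ib Hab) as [s [Hs Hne]]; apply Hne.
  assert (Hcst : forall x, a <= x <= b -> f x = f a).
  { intros x Hx; apply Rle_antisym; [rewrite Heq|]; apply Hmon; auto; lra. }
  apply (derive_zero_of_locally_constant f a b s); [|exact Hs|apply Hd, Hin; lra].
  intros x Hx; rewrite (Hcst x), (Hcst s); lra.
Qed.

(** Gives continuity at [f c] of the inverse of [f], without forming it. *)
Lemma strictly_increasing_close_preimage (I : R -> Prop) (f : R -> R) (c eta : R) :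
  strictly_increasing_on I f -> 0 < eta -> I (c - eta) -> I c -> I (c + eta) ->
  exists delta, 0 < delta /\
    forall s, I s -> Rabs (f s - f c) <= delta -> Rabs (s - c) < eta.
Proof.
  intros Hf Heta Il Ic Ir.
  assert (H1 : f (c - eta) < f c) by (apply Hf; auto; lra).
  assert (H2 : f c < f (c + eta)) by (apply Hf; auto; lra).
  exists (Rmin (f c - f (c - eta)) (f (c + eta) - f c) / 2).
  pose proof (Rmin_l (f c - f (c - eta)) (f (c + eta) - f c)).
  pose proof (Rmin_r (f c - f (c - eta)) (f (c + eta) - f c)).
  assert (0 < Rmin (f c - f (c - eta)) (f (c + eta) - f c)) by (apply Rmin_pos; lra).
  split; [lra|]; intros s Is Hs; apply Rabs_le_between in Hs.
  apply Rabs_def1.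
  - destruct (Rlt_le_dec s (c + eta)) as [|Hge]; [lra|exfalso].
    destruct Hge as [Hgt|Heq].
    + specialize (Hf (c + eta) s Ir Is Hgt); lra.
    + subst s; lra.
  - destruct (Rlt_le_dec (c - eta) s) as [|Hle]; [lra|exfalso].
    destruct Hle as [Hlt|Heq].
    + specialize (Hf s (c - eta) Is Il Hlt); lra.
    + subst s; lra.
Qed.

(** * Relative entropies *)

Definition relative_entropy (Phi : R -> R) (c s : R) : R :=
  Phi s - Phi c - Derive Phi c * (s - c).

Lemma is_derive_relative_entropy (Phi : R -> R) (c s : R) :
  ex_derive Phi s ->
  is_derive (relative_entropy Phi c) s (Derive Phi s - Derive Phi c).
Proof.
  intros Hs; unfold relative_entropy; auto_derive; [exact Hs|].
  replace (Derive (fun x => Phi x) s) with (Derive Phi s) by reflexivity; ring.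
Qed.

Lemma relative_entropy_nonneg (I : R -> Prop) (Phi : R -> R) (c s : R) :
  order_convex I -> (forall r, I r -> ex_derive Phi r) ->
  strictly_increasing_on I (Derive Phi) -> I c -> I s ->
  0 <= relative_entropy Phi c s.
Proof.
  intros HI Hd Hinc Ic Is.
  assert (Hle : forall x y, I x -> I y -> x <= y -> Derive Phi x <= Derive Phi y).
  { intros x y Ix Iy [Hxy| ->]; [left; apply Hinc; auto|lra]. }
  destruct (Rle_lt_dec c s) as [Hcs|Hsc].
  - destruct (MVT_on I Phi (Derive Phi) c s) as [r [Hr [Ir Heq]]]; auto.
    { intros; apply Derive_correct; auto. }
    assert (Derive Phi c <= Derive Phi r) by (apply Hle; auto; lra).
    unfold relative_entropy; nra.
  - destruct (MVT_on I Phi (Derive Phi) s c) as [r [Hr [Ir Heq]]]; auto.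
    { intros; apply Derive_correct; auto. } { lra. }
    assert (Derive Phi r <= Derive Phi c) by (apply Hle; auto; lra).
    unfold relative_entropy; nra.
Qed.

(** The relative entropy grows at least linearly away from [c]: beyond
    [c + eta] its slope is at least [Derive Phi (c + eta) - Derive Phi c], and
    symmetrically on the left. *)
Lemma relative_entropy_coercive (I : R -> Prop) (Phi : R -> R) (c eta : R) :
  order_convex I -> (forall r, I r -> ex_derive Phi r) ->
  strictly_increasing_on I (Derive Phi) ->
  0 < eta -> I (c - eta) -> I c -> I (c + eta) ->
  exists K, 0 < K /\
    forall s, I s -> Rabs (s - c) <= eta + K * relative_entropy Phi c s.
Proof.
  intros HI Hd Hinc Heta Il Ic Ir.
  assert (Hnn : forall s, I s -> 0 <= relative_entropy Phi c s)
    by (intros; eapply relative_entropy_nonneg; eauto).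
  assert (Hle : forall x y, I x -> I y -> x <= y -> Derive Phi x <= Derive Phi y).
  { intros x y Ix Iy [Hxy| ->]; [left; apply Hinc; auto|lra]. }
  assert (Hdr : forall s, I s ->
    is_derive (relative_entropy Phi c) s (Derive Phi s - Derive Phi c))
    by (intros; apply is_derive_relative_entropy; auto).
  assert (H1 : Derive Phi (c - eta) < Derive Phi c) by (apply Hinc; auto; lra).
  assert (H2 : Derive Phi c < Derive Phi (c + eta)) by (apply Hinc; auto; lra).
  set (g1 := Derive Phi c - Derive Phi (c - eta)).
  set (g2 := Derive Phi (c + eta) - Derive Phi c).
  assert (Hg1 : 0 < g1) by (unfold g1; lra).
  assert (Hg2 : 0 < g2) by (unfold g2; lra).
  assert (Hi1 : 0 < / g1) by (apply Rinv_0_lt_compat; auto).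
  assert (Hi2 : 0 < / g2) by (apply Rinv_0_lt_compat; auto).
  assert (Hs1 : forall g r e, 0 < g -> g * r <= e -> r <= / g * e).
  { intros g r e Hg Hre; apply Rmult_le_reg_l with g; auto.
    rewrite <- Rmult_assoc, Rinv_r by lra; lra. }
  exists (/ g1 + / g2); split; [lra|]; intros s Is.
  specialize (Hnn s Is) as Hs.
  assert (0 <= / g1 * relative_entropy Phi c s) by (apply Rmult_le_pos; lra).
  assert (0 <= / g2 * relative_entropy Phi c s) by (apply Rmult_le_pos; lra).
  rewrite Rmult_plus_distr_r.
  destruct (Rle_lt_dec s (c + eta)) as [Hsr|Hsr].
  - destruct (Rle_lt_dec (c - eta) s) as [Hsl|Hsl].
    + assert (Rabs (s - c) <= eta) by (apply Rabs_le; lra); lra.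
    + rewrite Rabs_left by lra.
      destruct (MVT_on I _ _ s (c - eta) HI Hdr) as [r [Hr [Ir' Heq]]]; auto; [lra|].
      assert (Derive Phi r <= Derive Phi (c - eta)) by (apply Hle; auto; lra).
      specialize (Hnn (c - eta) Il).
      assert (c - eta - s <= / g1 * relative_entropy Phi c s); [|lra].
      apply Hs1; auto; unfold g1; nra.
  - rewrite Rabs_right by lra.
    destruct (MVT_on I _ _ (c + eta) s HI Hdr) as [r [Hr [Ir' Heq]]]; auto; [lra|].
    assert (Derive Phi (c + eta) <= Derive Phi r) by (apply Hle; auto; lra).
    specialize (Hnn (c + eta) Ir).
    assert (s - (c + eta) <= / g2 * relative_entropy Phi c s); [|lra].
    apply Hs1; auto; unfold g2; nra.
Qed.

Lemma relative_entropy_small_near (Phi : R -> R) (c kappa : R) :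
  ex_derive Phi c -> 0 < kappa ->
  exists eta, 0 < eta /\
    forall s, Rabs (s - c) < eta -> relative_entropy Phi c s <= kappa.
Proof.
  intros Hc Hk.
  assert (Hcont := is_derive_continuity_pt _ _ _ (is_derive_relative_entropy Phi c c Hc)).
  destruct (proj1 (continuity_pt_locally _ _) Hcont (mkposreal kappa Hk)) as [eta Heta].
  exists eta; split; [apply cond_pos|]; intros s Hs.
  assert (H : Rabs (relative_entropy Phi c s - relative_entropy Phi c c) < kappa)
    by exact (Heta s Hs).
  replace (relative_entropy Phi c c) with 0 in H by (unfold relative_entropy; ring).
  apply Rabs_def2 in H; lra.
Qed.

(** * Second derivatives of strictly convex and of strictly increasing data *)

Lemma right_minimum_derive_nonneg (f : R -> R) (x l r : R) :
  0 < r -> (forall h, 0 < h < r -> f x <= f (x + h)) -> is_derive f x l -> 0 <= l.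
Proof.
  intros Hr Hf Hl.
  destruct (Rle_lt_dec 0 l) as [|Hneg]; [assumption|exfalso].
  apply is_derive_Reals in Hl.
  destruct (Hl (- l)) as [d Hd]; [lra|].
  pose proof (cond_pos d) as Hdpos.
  set (h := Rmin d r / 2).
  pose proof (Rmin_l d r); pose proof (Rmin_r d r).
  assert (0 < Rmin d r) by (apply Rmin_pos; auto).
  assert (Hh : 0 < h) by (unfold h; lra).
  specialize (Hd h ltac:(lra)); rewrite Rabs_right in Hd by lra.
  specialize (Hd ltac:(unfold h; lra)); apply Rabs_def2 in Hd.
  specialize (Hf h ltac:(unfold h; lra)).
  assert (0 <= (f (x + h) - f x) / h).
  { apply Rmult_le_pos; [lra|]; left; apply Rinv_0_lt_compat; lra. }
  lra.
Qed.

(** The chord from [a] to [b] minus the graph is nonnegative and vanishes at [a],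
    so its derivative there in the direction of [b] is nonnegative. *)
Lemma convex_above_tangent (f : R -> R) (a b : R) :
  strictly_convex_on whole_line f -> ex_derive f a ->
  Derive f a * (b - a) <= f b - f a.
Proof.
  intros Hf Ha.
  destruct (Req_dec a b) as [->|Hne]; [lra|].
  set (gap := fun l => l * (f b - f a) - (f (a + l * (b - a)) - f a)).
  assert (Hg : is_derive gap 0 (f b - f a - Derive f a * (b - a))).
  { unfold gap; auto_derive.
    - replace (a + 0 * (b - a)) with a by ring; exact Ha.
    - replace (a + 0 * (b - a)) with a by ring.
      replace (Derive (fun x => f x) a) with (Derive f a) by reflexivity; ring. }
  assert (0 <= f b - f a - Derive f a * (b - a)); [|lra].
  apply (right_minimum_derive_nonneg gap 0 _ 1); [lra| |exact Hg].
  intros h Hh.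
  assert (Hc := Hf b a h I I ltac:(auto) Hh).
  unfold gap; rewrite Rplus_0_l.
  replace (a + 0 * (b - a)) with a by ring.
  replace (a + h * (b - a)) with (h * b + (1 - h) * a) by ring; nra.
Qed.

Lemma strictly_convex_second_derive (f : R -> R) :
  C_class 2 whole_line f -> strictly_convex_on whole_line f ->
  nonneg_nowhere_flat whole_line (Derive_n f 2).
Proof.
  intros HC Hf.
  assert (Hd1 : forall s, ex_derive f s)
    by (intros s; apply (HC 1%nat ltac:(auto) s I)).
  assert (Hd2 : forall s, is_derive (Derive f) s (Derive_n f 2 s))
    by (intros s; apply Derive_correct; apply (HC 2%nat ltac:(auto) s I)).
  split.
  - intros s _; apply (right_minimum_derive_nonneg (Derive f) s _ 1); [lra| |auto].
    intros h Hh.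
    assert (Ht1 := convex_above_tangent f s (s + h) Hf (Hd1 _)).
    assert (Ht2 := convex_above_tangent f (s + h) s Hf (Hd1 _)).
    apply Rmult_le_reg_l with h; [lra|]; nra.
  - intros a b _ _ Hab; apply NNPP; intros Hno.
    assert (Hz : forall s, a < s < b -> Derive_n f 2 s = 0).
    { intros s Hs; apply NNPP; intros Hne; apply Hno; exists s; auto. }
    (* Inside [a, b] the derivative is constant, hence so are the slopes of [f]
       on the two halves of the middle third, against strict convexity. *)
    set (l := (2 * a + b) / 3); set (d := (b - a) / 6).
    assert (Hcst : forall x, l <= x <= l + 2 * d -> Derive f x = Derive f l).
    { intros x Hx.
      destruct (MVT_on whole_line (Derive f) (Derive_n f 2) l x
                  order_convex_whole_line (fun s _ => Hd2 s) I I)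
        as [c [Hc [_ Heq]]]; [lra|].
      rewrite Hz in Heq by (unfold l, d in *; lra); lra. }
    assert (Hslope : forall x y, l <= x -> x <= y -> y <= l + 2 * d ->
              f y - f x = Derive f l * (y - x)).
    { intros x y Hx Hxy Hy.
      destruct (MVT_on whole_line f (Derive f) x y order_convex_whole_line)
        as [c [Hc [_ Heq]]]; try exact I; try lra.
      { intros; apply Derive_correct, Hd1. }
      rewrite Hcst in Heq by lra; exact Heq. }
    assert (Hd : 0 < d) by (unfold d; lra).
    assert (Hconv := Hf l (l + 2 * d) (1 / 2) I I ltac:(lra) ltac:(lra)).
    replace (1 / 2 * l + (1 - 1 / 2) * (l + 2 * d)) with (l + d) in Hconv by lra.
    assert (E1 := Hslope l (l + d) ltac:(lra) ltac:(lra) ltac:(lra)).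
    assert (E2 := Hslope (l + d) (l + 2 * d) ltac:(lra) ltac:(lra) ltac:(lra)).
    nra.
Qed.

Lemma strictly_increasing_derive_quotient (g q : R -> R) :
  C_class 1 pos_half_line g -> strictly_increasing_on pos_half_line g ->
  (forall s, 0 < s -> q s = Derive g s / s) ->
  nonneg_nowhere_flat pos_half_line q.
Proof.
  intros HC Hg Hq.
  assert (Hd : forall s, pos_half_line s -> is_derive g s (Derive g s))
    by (intros s Hs; apply Derive_correct; apply (HC 1%nat ltac:(auto) s Hs)).
  split.
  - intros s Hs; rewrite Hq by exact Hs.
    apply Rmult_le_pos; [|left; apply Rinv_0_lt_compat; exact Hs].
    apply (right_minimum_derive_nonneg g s _ 1); [lra| |auto].
    intros h Hh; left; apply Hg; unfold pos_half_line in *; lra.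
  - unfold pos_half_line; intros a b Ia Ib Hab; apply NNPP; intros Hno.
    (* A flat stretch of [q] would make [g] constant on the middle third. *)
    destruct (MVT_on pos_half_line g (Derive g) ((2 * a + b) / 3) ((a + 2 * b) / 3)
                order_convex_pos_half_line Hd) as [c [Hc [Ic Heq]]];
      unfold pos_half_line in *; try lra.
    assert (Hlt := Hg ((2 * a + b) / 3) ((a + 2 * b) / 3) ltac:(unfold pos_half_line; lra)
                     ltac:(unfold pos_half_line; lra) ltac:(lra)).
    apply Hno; exists c; split; [lra|]; rewrite Hq by exact Ic; intros Hz.
    assert (Derive g c = 0).
    { replace (Derive g c) with (Derive g c / c * c) by (field; lra); rewrite Hz; ring. }
    rewrite H in Heq; lra.
Qed.

Lemma nonneg_nowhere_flat_sqrt (I : R -> Prop) (f h : R -> R) :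
  (forall s, I s -> h s = sqrt (f s)) -> order_convex I ->
  nonneg_nowhere_flat I f -> nonneg_nowhere_flat I h.
Proof.
  intros Hh HI [Hp Hn]; split.
  - intros s Is; rewrite Hh by exact Is; apply sqrt_pos.
  - intros a b Ia Ib Hab; destruct (Hn a b Ia Ib Hab) as [s [Hs Hne]].
    assert (Is : I s) by (apply (HI a b); auto; lra).
    exists s; split; [exact Hs|]; rewrite Hh by exact Is; intros Hz.
    apply Hne, sqrt_eq_0; auto.
Qed.

(** * Calculus on the torus *)

Lemma is_derive_primitive (f : R -> R) (s : R) :
  (forall x, continuous f x) -> is_derive (fun r => RInt f 0 r) s (f s).
Proof.
  intros Hf; apply (is_derive_RInt f (fun r => RInt f 0 r) 0 s); [|apply Hf].
  apply filter_forall; intros r; apply (RInt_correct (V := R_CompleteNormedModule)).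
  apply (ex_RInt_continuous (V := R_CompleteNormedModule)); intros; apply Hf.
Qed.

Lemma ex_torus_int (f : R -> R) :
  (forall x, continuous f x) -> ex_RInt f 0 1.
Proof.
  intros Hf; apply (ex_RInt_continuous (V := R_CompleteNormedModule)).
  intros; apply Hf.
Qed.

Lemma torus_int_plus (f g : R -> R) :
  (forall x, continuous f x) -> (forall x, continuous g x) ->
  torus_int (fun x => f x + g x) = torus_int f + torus_int g.
Proof.
  intros Hf Hg.
  apply (RInt_plus (V := R_CompleteNormedModule)); apply ex_torus_int; assumption.
Qed.

Lemma torus_int_scal (c : R) (f : R -> R) :
  (forall x, continuous f x) -> torus_int (fun x => c * f x) = c * torus_int f.
Proof.
  intros Hf; apply (RInt_scal (V := R_CompleteNormedModule)), ex_torus_int, Hf.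
Qed.

Lemma torus_int_const (c : R) : torus_int (fun _ => c) = c.
Proof.
  unfold torus_int; rewrite RInt_const; unfold scal; simpl; unfold mult; simpl; ring.
Qed.

Lemma torus_int_ext (f g : R -> R) :
  (forall x, f x = g x) -> torus_int f = torus_int g.
Proof. intros H; apply RInt_ext; intros; apply H. Qed.

Lemma torus_int_le (f g : R -> R) :
  (forall x, continuous f x) -> (forall x, continuous g x) ->
  (forall x, 0 <= x <= 1 -> f x <= g x) -> torus_int f <= torus_int g.
Proof.
  intros Hf Hg Hle; apply RInt_le; try (apply ex_torus_int; assumption); [lra|].
  intros; apply Hle; lra.
Qed.

Lemma torus_int_nonneg (f : R -> R) :
  (forall x, continuous f x) -> (forall x, 0 <= f x) -> 0 <= torus_int f.
Proof.
  intros Hf Hle; apply RInt_ge_0; [lra|apply ex_torus_int, Hf|intros; apply Hle].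
Qed.

Lemma torus_int_derive (W dW : R -> R) :
  (forall x, is_derive W x (dW x)) -> (forall x, continuous dW x) -> W 1 = W 0 ->
  torus_int dW = 0.
Proof.
  intros Hd Hc Hper; unfold torus_int.
  rewrite (is_RInt_unique _ _ _ _ (is_RInt_derive W dW 0 1
             (fun x _ => Hd x) (fun x _ => Hc x))).
  unfold minus, plus, opp; simpl; rewrite Hper; ring.
Qed.

(** The mean value theorem for a primitive of [u]. *)
Lemma torus_mean_attained (u : R -> R) :
  (forall x, continuous u x) -> exists x, 0 <= x <= 1 /\ u x = torus_int u.
Proof.
  intros Hu.
  destruct (MVT_on whole_line (fun r => RInt u 0 r) u 0 1 order_convex_whole_line)
    as [c [Hc [_ Heq]]]; try exact I; [|lra|].
  - intros s _; apply is_derive_primitive, Hu.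
  - exists c; split; [exact Hc|].
    change (RInt u 0 1) with (torus_int u) in Heq.
    rewrite (RInt_point (V := R_CompleteNormedModule)) in Heq.
    change (zero : R) with 0 in Heq; lra.
Qed.

(** By the inequality of arithmetic and geometric means,
    [|dw| <= lam / 2 + dw ^ 2 / (2 * lam)], and a primitive [B] of the right-hand
    side increases by at most [lam] over a period. *)
Lemma torus_oscillation (w dw : R -> R) (lam x y : R) :
  (forall s, is_derive w s (dw s)) -> (forall s, continuous dw s) ->
  0 < lam -> torus_int (fun s => dw s ^ 2) <= lam ^ 2 ->
  0 <= x <= 1 -> 0 <= y <= 1 -> Rabs (w x - w y) <= lam.
Proof.
  intros Hw Hdw Hlam Hint.
  assert (Hsq : forall s, continuous (fun r => dw r ^ 2) s).
  { intros s; apply continuous_ext with (fun r => mult (dw r) (dw r)).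
    - intros r; unfold mult; simpl; ring.
    - apply (continuous_mult dw dw s); apply Hdw. }
  set (B := fun s => lam / 2 * s + / (2 * lam) * RInt (fun r => dw r ^ 2) 0 s).
  assert (HB : forall s, is_derive B s (lam / 2 + / (2 * lam) * dw s ^ 2)).
  { intros s; unfold B; apply (is_derive_plus (V := R_NormedModule)).
    - auto_derive; [exact I|ring].
    - apply is_derive_scal, (is_derive_primitive (fun r => dw r ^ 2)), Hsq. }
  assert (Hil : 0 < / (2 * lam)) by (apply Rinv_0_lt_compat; lra).
  assert (Hage : forall s, Rabs (dw s) <= lam / 2 + / (2 * lam) * dw s ^ 2).
  { intros s; apply Rmult_le_reg_l with (2 * lam); [lra|].
    replace (2 * lam * (lam / 2 + / (2 * lam) * dw s ^ 2))
      with (lam ^ 2 + dw s ^ 2) by (field; lra).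
    assert (0 <= (lam - Rabs (dw s)) ^ 2) by apply pow2_ge_0.
    rewrite <- (pow2_abs (dw s)); nra. }
  assert (Hmon : forall f df, (forall s, is_derive f s (df s)) ->
            (forall s, 0 <= df s) -> forall a b, a <= b -> f a <= f b).
  { intros f df Hf Hp a b; apply (nondecreasing_of_derive whole_line f df);
      try exact I; auto using order_convex_whole_line. }
  assert (Htot : B 1 - B 0 <= lam).
  { unfold B; rewrite (RInt_point (V := R_CompleteNormedModule)).
    change (RInt (fun r => dw r ^ 2) 0 1) with (torus_int (fun r => dw r ^ 2)).
    change (zero : R) with 0.
    assert (/ (2 * lam) * torus_int (fun r => dw r ^ 2) <= / (2 * lam) * lam ^ 2)
      by (apply Rmult_le_compat_l; lra).
    replace (/ (2 * lam) * lam ^ 2) with (lam / 2) in H by (field; lra); lra. }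
  assert (Hord : forall a b, 0 <= a -> a <= b -> b <= 1 -> Rabs (w b - w a) <= lam).
  { intros a b Ha Hab Hb.
    assert (H1 : B a - w a <= B b - w b).
    { apply (Hmon (fun s => B s - w s)
               (fun s => lam / 2 + / (2 * lam) * dw s ^ 2 - dw s)); [|intros s|lra].
      - intros s; apply (is_derive_minus (V := R_NormedModule)); auto.
      - specialize (Hage s); pose proof (Rle_abs (dw s)); lra. }
    assert (H2 : B a + w a <= B b + w b).
    { apply (Hmon (fun s => B s + w s)
               (fun s => lam / 2 + / (2 * lam) * dw s ^ 2 + dw s)); [|intros s|lra].
      - intros s; apply (is_derive_plus (V := R_NormedModule)); auto.
      - specialize (Hage s); pose proof (Rcomplements.Rabs_maj2 (dw s)); lra. }
    assert (HBm : forall s r, s <= r -> B s <= B r).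
    { apply (Hmon B _ HB); intros s.
      specialize (Hage s); pose proof (Rabs_pos (dw s)); lra. }
    assert (B 0 <= B a) by (apply HBm; lra).
    assert (B b <= B 1) by (apply HBm; lra).
    apply Rabs_le; lra. }
  intros Hx Hy; destruct (Rle_lt_dec x y).
  - rewrite Rabs_minus_sym; apply Hord; lra.
  - apply Hord; lra.
Qed.

(** * Functions of space and time *)

Definition continuous_at_positive_times (f : R -> R -> R) : Prop :=
  forall x t : R, 0 < t -> continuity_2d_pt f x t.

Lemma continuity_2d_pt_slice (f : R -> R -> R) (x t : R) :
  continuity_2d_pt f x t -> continuous (fun y => f y t) x.
Proof.
  intros Hf; apply continuity_pt_filterlim, continuity_pt_locally; intros e.
  destruct (Hf e) as [d Hd]; exists d; intros y Hy.
  apply Hd; [exact Hy|rewrite Rminus_diag, Rabs_R0; apply cond_pos].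
Qed.

Lemma positive_times_slice (f : R -> R -> R) (t : R) :
  continuous_at_positive_times f -> 0 < t ->
  forall x, continuous (fun y => f y t) x.
Proof. intros Hf Ht x; apply continuity_2d_pt_slice, Hf, Ht. Qed.

Lemma locally_positive (t : R) : 0 < t -> locally t (fun s => 0 < s).
Proof.
  intros Ht; exists (mkposreal t Ht); intros s Hs.
  assert (H : Rabs (s - t) < t) by exact Hs; apply Rabs_def2 in H; lra.
Qed.

Lemma is_derive_torus_int (f df : R -> R -> R) (t : R) :
  continuous_at_positive_times f -> continuous_at_positive_times df ->
  (forall x s, 0 < s -> is_derive (fun r => f x r) s (df x s)) -> 0 < t ->
  is_derive (fun s => torus_int (fun x => f x s)) t (torus_int (fun x => df x t)).
Proof.
  intros Hf Hdf Hd Ht.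
  assert (HD : forall x s, 0 < s -> Derive (fun r => f x r) s = df x s)
    by (intros; apply is_derive_unique, Hd; assumption).
  unfold torus_int.
  rewrite <- (RInt_ext (V := R_CompleteNormedModule)
                (fun x => Derive (fun r => f x r) t) (fun x => df x t) 0 1)
    by (intros; apply HD, Ht).
  apply (is_derive_RInt_param (fun s x => f x s) 0 1 t).
  - generalize (locally_positive t Ht); apply filter_imp; intros s Hs x _.
    exists (df x s); apply Hd, Hs.
  - intros x _.
    apply continuity_2d_pt_ext_loc with (fun s y => df y s).
    + destruct (locally_positive t Ht) as [d Hpos]; exists d; intros s y Hs _.
      symmetry; apply HD, Hpos, Hs.
    + intros e; destruct (Hdf x t Ht e) as [d Hd']; exists d; intros s y Hs Hy.
      apply Hd'; assumption.
  - generalize (locally_positive t Ht); apply filter_imp; intros s Hs.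
    apply ex_torus_int, positive_times_slice; assumption.
Qed.

Lemma continuity_2d_pt_comp_derivable (phi : R -> R) (f : R -> R -> R) (x t l : R) :
  is_derive phi (f x t) l -> continuity_2d_pt f x t ->
  continuity_2d_pt (fun y s => phi (f y s)) x t.
Proof.
  intros Hphi Hf; apply continuity_1d_2d_pt_comp; [|exact Hf].
  exact (is_derive_continuity_pt _ _ _ Hphi).
Qed.

Lemma is_derive_eq (f : R -> R) (x l l' : R) :
  is_derive f x l -> l = l' -> is_derive f x l'.
Proof. intros H <-; exact H. Qed.

Lemma is_derive_chain (f u : R -> R) (x df du : R) :
  is_derive f (u x) df -> is_derive u x du ->
  is_derive (fun y => f (u y)) x (df * du).
Proof.
  intros Hf Hu; rewrite Rmult_comm; exact (is_derive_comp f u x df du Hf Hu).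
Qed.

Lemma is_derive_product (f u : R -> R) (x df du : R) :
  is_derive f x df -> is_derive u x du ->
  is_derive (fun y => f y * u y) x (df * u x + f x * du).
Proof. intros Hf Hu; exact (is_derive_mult f u x df du Hf Hu Rmult_comm). Qed.

Lemma is_derive_sum (f u : R -> R) (x df du : R) :
  is_derive f x df -> is_derive u x du ->
  is_derive (fun y => f y + u y) x (df + du).
Proof. intros Hf Hu; exact (is_derive_plus f u x df du Hf Hu). Qed.

Lemma is_derive_difference (f u : R -> R) (x df du : R) :
  is_derive f x df -> is_derive u x du ->
  is_derive (fun y => f y - u y) x (df - du).
Proof. intros Hf Hu; exact (is_derive_minus f u x df du Hf Hu). Qed.

Lemma is_derive_const_mult (f : R -> R) (x c df : R) :
  is_derive f x df -> is_derive (fun y => c * f y) x (c * df).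
Proof. intros Hf; exact (is_derive_scal f x c df Hf). Qed.

Lemma C_class_is_derive (n k : nat) (I : R -> Prop) (f : R -> R) (s : R) :
  C_class n I f -> (S k <= n)%nat -> I s ->
  is_derive (Derive_n f k) s (Derive_n f (S k) s).
Proof.
  intros Hf Hk Is; apply Derive_correct; apply (Hf (S k) Hk s Is).
Qed.

Lemma C_class_continuity_pt (n k : nat) (I : R -> Prop) (f : R -> R) (s : R) :
  C_class n I f -> (k <= n)%nat -> I s -> continuity_pt (Derive_n f k) s.
Proof.
  intros Hf Hk Is; apply continuity_pt_filterlim; apply (Hf k Hk s Is).
Qed.

Section ClassicalRegularity.
Context (u : R -> R -> R) (Hu : classical_regularity u).

Lemma regular_continuous : continuous_at_positive_times u.
Proof. intros x t Ht; apply (proj1 (proj2 Hu) x t Ht). Qed.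

Lemma regular_continuous_dx : continuous_at_positive_times (d_x u).
Proof.
  intros x t Ht.
  destruct (proj1 (proj2 Hu) x t Ht) as (_ & _ & _ & [H _] & _); exact H.
Qed.

Lemma regular_continuous_dt : continuous_at_positive_times (d_t u).
Proof.
  intros x t Ht.
  destruct (proj1 (proj2 Hu) x t Ht) as (_ & _ & _ & _ & [H _]); exact H.
Qed.

Lemma regular_is_derive_x (x t : R) :
  0 < t -> is_derive (fun y => u y t) x (d_x u x t).
Proof.
  intros Ht; apply Derive_correct.
  destruct (proj1 (proj2 Hu) x t Ht) as (_ & H & _); exact H.
Qed.

Lemma regular_is_derive_t (x t : R) :
  0 < t -> is_derive (fun s => u x s) t (d_t u x t).
Proof.
  intros Ht; apply Derive_correct.
  destruct (proj1 (proj2 Hu) x t Ht) as (_ & _ & H & _); exact H.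
Qed.

Lemma regular_is_derive_xx (x t : R) :
  0 < t -> is_derive (fun y => d_x u y t) x (d_xx u x t).
Proof.
  intros Ht; apply Derive_correct.
  destruct (proj1 (proj2 Hu) x t Ht) as (_ & _ & _ & (_ & H & _) & _); exact H.
Qed.

Lemma regular_periodic (t : R) : 0 < t -> u 1 t = u 0 t.
Proof.
  intros Ht; rewrite <- (proj1 Hu 0 t) by lra; now rewrite Rplus_0_l.
Qed.

Lemma regular_periodic_dx (t : R) : 0 < t -> d_x u 1 t = d_x u 0 t.
Proof.
  intros Ht; symmetry; apply is_derive_unique.
  apply (is_derive_ext (fun y => u (y + 1) t)).
  { intros y; apply (proj1 Hu); lra. }
  apply is_derive_eq with (d_x u 1 t * 1); [|ring].
  apply (is_derive_chain (fun y => u y t) (fun y => y + 1)).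
  - rewrite Rplus_0_l; apply regular_is_derive_x, Ht.
  - auto_derive; [exact I|ring].
Qed.

(** Extending [u] to negative times by [u x 0] turns one-sided continuity into
    continuity in the plane, for which uniform continuity on compact sets is
    available. *)
Lemma regular_continuous_extension (x : R) :
  continuity_2d_pt (fun y s => u y (Rmax 0 s)) x 0.
Proof.
  intros e.
  assert (Hc := proj2 (proj2 Hu) (x, 0) (Rle_refl 0)).
  destruct (Hc (fun r => Rabs (r - u x 0) < e)) as [d Hd].
  { exists e; intros r Hr; exact Hr. }
  exists d; intros y s Hy Hs.
  rewrite (Rmax_left 0 0) by lra.
  apply (Hd (y, Rmax 0 s)); [split|exact (Rmax_l 0 s)]; [exact Hy|].
  change (Rabs (Rmax 0 s - 0) < d); rewrite Rminus_0_r in Hs |- *.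
  unfold Rmax; destruct (Rle_dec 0 s); [exact Hs|].
  rewrite Rabs_R0; apply cond_pos.
Qed.

Lemma regular_initial_mean (e : R) :
  0 < e -> exists d, 0 < d /\ forall t, 0 < t < d ->
    Rabs (torus_int (fun x => u x t) - torus_int (fun x => u x 0)) <= e.
Proof.
  intros He.
  destruct (uniform_continuity_2d_1d (fun y s => u y (Rmax 0 s)) 0 1 0
              (fun x _ => regular_continuous_extension x) (mkposreal e He)) as [d Hd].
  exists d; split; [apply cond_pos|]; intros t Ht.
  assert (Hc0 : forall x, continuous (fun y => u y 0) x).
  { intros x; apply continuous_ext with (fun y => u y (Rmax 0 0)).
    - intros y; now rewrite Rmax_left by lra.
    - apply (continuity_2d_pt_slice (fun y s => u y (Rmax 0 s))).
      apply regular_continuous_extension. }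
  assert (Hct : forall x, continuous (fun y => u y t) x)
    by (apply positive_times_slice; [exact regular_continuous|lra]).
  assert (Hclose : forall x, 0 <= x <= 1 -> Rabs (u x t - u x 0) < e).
  { intros x Hx.
    assert (H := Hd x 0 x t Hx ltac:(lra) Hx ltac:(lra)).
    cbv beta in H; rewrite (Rmax_left 0 0), (Rmax_right 0 t) in H by lra.
    apply H; rewrite Rminus_diag, Rabs_R0; apply cond_pos. }
  assert (Hce : forall x : R, continuous (fun _ : R => e) x)
    by (intros; apply continuous_const).
  assert (H1 : torus_int (fun x => u x t) <= torus_int (fun x => u x 0 + e)).
  { apply torus_int_le; [exact Hct|intros x; apply (continuous_plus (fun y => u y 0)); auto|].
    intros x Hx; specialize (Hclose x Hx); apply Rabs_def2 in Hclose; lra. }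
  assert (H2 : torus_int (fun x => u x 0) <= torus_int (fun x => u x t + e)).
  { apply torus_int_le; [exact Hc0|intros x; apply (continuous_plus (fun y => u y t)); auto|].
    intros x Hx; specialize (Hclose x Hx); apply Rabs_def2 in Hclose; lra. }
  rewrite torus_int_plus, torus_int_const in H1, H2 by assumption.
  apply Rabs_le; lra.
Qed.

(** The mean is constant for [t > 0], and the constant is identified by letting
    [t] tend to [0]. *)
Lemma mean_conserved :
  (forall t, 0 < t -> torus_int (fun x => d_t u x t) = 0) ->
  forall t, 0 < t -> torus_int (fun x => u x t) = torus_int (fun x => u x 0).
Proof.
  intros Hz.
  assert (Hd : forall t, pos_half_line t ->
            is_derive (fun s => torus_int (fun x => u x s)) t 0).
  { intros t Ht; rewrite <- (Hz t Ht).
    apply is_derive_torus_int; [exact regular_continuous|exact regular_continuous_dt| |exact Ht].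
    intros; apply regular_is_derive_t; assumption. }
  intros t Ht; apply cond_eq; intros e He.
  destruct (regular_initial_mean (e / 2) ltac:(lra)) as [d [Hd0 Hd1]].
  set (s := Rmin t (d / 2)).
  assert (Hs : 0 < s) by (apply Rmin_pos; lra).
  assert (Hst : s <= t) by apply Rmin_l.
  assert (Hsd : s <= d / 2) by apply Rmin_r.
  destruct (MVT_on pos_half_line _ (fun _ => 0) s t order_convex_pos_half_line Hd
              Hs Ht Hst) as [c [_ [_ Heq]]].
  specialize (Hd1 s ltac:(lra)).
  replace (torus_int (fun x => u x t)) with (torus_int (fun x => u x s)) by lra; lra.
Qed.

End ClassicalRegularity.

(** * Conservation laws and entropy dissipation *)

(** The regularity, positivity and equations from which the conservation laws and
    the entropy identity follow. *)
Record system_solution (eps : R) (H g P : R -> R) (v m : R -> R -> R) : Prop := {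
  sol_H : C_class 2 whole_line H;
  sol_g : C_class 1 pos_half_line g;
  sol_P : C_class 2 pos_half_line P;
  sol_P2 : forall s : R, 0 < s -> Derive_n P 2 s = Derive g s / s;
  sol_v : classical_regularity v;
  sol_m : classical_regularity m;
  sol_m_pos : forall x t : R, 0 < t -> 0 < m x t;
  sol_eqs : solves_system eps H g v m }.

Arguments sol_H {eps H g P v m}.
Arguments sol_g {eps H g P v m}.
Arguments sol_P {eps H g P v m}.
Arguments sol_P2 {eps H g P v m}.
Arguments sol_v {eps H g P v m}.
Arguments sol_m {eps H g P v m}.
Arguments sol_m_pos {eps H g P v m}.
Arguments sol_eqs {eps H g P v m}.

Section Solution.
Context (eps : R) (H g P : R -> R) (v m : R -> R -> R).
Context (sol : system_solution eps H g P v m).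

Let dH (s : R) : is_derive H s (Derive H s) :=
  C_class_is_derive 2 0 whole_line H s (sol_H sol) ltac:(auto) I.
Let ddH (s : R) : is_derive (Derive H) s (Derive_n H 2 s) :=
  C_class_is_derive 2 1 whole_line H s (sol_H sol) ltac:(auto) I.
Let dP (s : R) (Hs : 0 < s) : is_derive P s (Derive P s) :=
  C_class_is_derive 2 0 pos_half_line P s (sol_P sol) ltac:(auto) Hs.
Let ddP (s : R) (Hs : 0 < s) : is_derive (Derive P) s (Derive_n P 2 s) :=
  C_class_is_derive 2 1 pos_half_line P s (sol_P sol) ltac:(auto) Hs.
Let dg (s : R) (Hs : 0 < s) : is_derive g s (Derive g s) :=
  C_class_is_derive 1 0 pos_half_line g s (sol_g sol) ltac:(auto) Hs.
Let mpos := sol_m_pos sol.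
Let dvx := regular_is_derive_x v (sol_v sol).
Let dmx := regular_is_derive_x m (sol_m sol).
Let dvxx := regular_is_derive_xx v (sol_v sol).
Let dmxx := regular_is_derive_xx m (sol_m sol).
Let dvt := regular_is_derive_t v (sol_v sol).
Let dmt := regular_is_derive_t m (sol_m sol).
Let cv := regular_continuous v (sol_v sol).
Let cm := regular_continuous m (sol_m sol).
Let cvx := regular_continuous_dx v (sol_v sol).
Let cmx := regular_continuous_dx m (sol_m sol).
Let cvt := regular_continuous_dt v (sol_v sol).
Let cmt := regular_continuous_dt m (sol_m sol).

Lemma velocity_equation (x t : R) : 0 < t ->
  d_t v x t = eps * d_xx v x t
    - (Derive H (v x t) * d_x v x t - Derive g (m x t) * d_x m x t).
Proof.
  intros Ht; destruct (sol_eqs sol x t Ht) as [E _]; rewrite <- E.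
  assert (D : d_x (fun y s => H (v y s) - g (m y s)) x t
    = Derive H (v x t) * d_x v x t - Derive g (m x t) * d_x m x t).
  { apply is_derive_unique, is_derive_difference.
    - apply (is_derive_chain H (fun y => v y t)); auto.
    - apply (is_derive_chain g (fun y => m y t)); auto. }
  rewrite D; ring.
Qed.

Lemma density_equation (x t : R) : 0 < t ->
  d_t m x t = eps * d_xx m x t
    + (d_x m x t * Derive H (v x t) + m x t * (Derive_n H 2 (v x t) * d_x v x t)).
Proof.
  intros Ht; destruct (sol_eqs sol x t Ht) as [_ E]; rewrite <- E.
  assert (D : d_x (fun y s => m y s * Derive H (v y s)) x t
    = d_x m x t * Derive H (v x t) + m x t * (Derive_n H 2 (v x t) * d_x v x t)).
  { apply is_derive_unique.
    apply (is_derive_product (fun y => m y t) (fun y => Derive H (v y t))); auto.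
    apply (is_derive_chain (Derive H) (fun y => v y t)); auto. }
  rewrite D; ring.
Qed.

Lemma velocity_mean_conserved (t : R) :
  0 < t -> torus_int (fun x => v x t) = torus_int (fun x => v x 0).
Proof.
  apply mean_conserved; [apply (sol_v sol)|clear t; intros t Ht].
  apply (torus_int_derive (fun x => eps * d_x v x t - (H (v x t) - g (m x t)))).
  - intros x; rewrite (velocity_equation x t Ht).
    apply is_derive_difference.
    + apply is_derive_const_mult; auto.
    + apply is_derive_difference.
      * apply (is_derive_chain H (fun y => v y t)); auto.
      * apply (is_derive_chain g (fun y => m y t)); auto.
  - apply positive_times_slice; auto.
  - rewrite (regular_periodic_dx v (sol_v sol)),
      (regular_periodic v (sol_v sol)),
      (regular_periodic m (sol_m sol)) by exact Ht; reflexivity.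
Qed.

Lemma density_mean_conserved (t : R) :
  0 < t -> torus_int (fun x => m x t) = torus_int (fun x => m x 0).
Proof.
  apply mean_conserved; [apply (sol_m sol)|clear t; intros t Ht].
  apply (torus_int_derive (fun x => eps * d_x m x t + m x t * Derive H (v x t))).
  - intros x; rewrite (density_equation x t Ht).
    apply is_derive_sum.
    + apply is_derive_const_mult; auto.
    + apply (is_derive_product (fun y => m y t) (fun y => Derive H (v y t))); auto.
      apply (is_derive_chain (Derive H) (fun y => v y t)); auto.
  - apply positive_times_slice; auto.
  - rewrite (regular_periodic_dx m (sol_m sol)),
      (regular_periodic v (sol_v sol)),
      (regular_periodic m (sol_m sol)) by exact Ht; reflexivity.
Qed.

Definition entropy (t : R) : R := torus_int (fun x => H (v x t) + P (m x t)).

Definition dissipation_density (x t : R) : R :=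
  Derive_n H 2 (v x t) * d_x v x t ^ 2 + Derive_n P 2 (m x t) * d_x m x t ^ 2.

Definition dissipation (t : R) : R := torus_int (fun x => dissipation_density x t).

Lemma continuous_velocity_dissipation :
  continuous_at_positive_times (fun x t => Derive_n H 2 (v x t) * d_x v x t ^ 2).
Proof.
  intros x t Ht; apply continuity_2d_pt_mult.
  - apply continuity_1d_2d_pt_comp; [|auto].
    apply (C_class_continuity_pt 2 2 whole_line); auto; [apply (sol_H sol)|exact I].
  - apply continuity_2d_pt_ext with (fun y s => d_x v y s * d_x v y s); [intros; ring|].
    apply continuity_2d_pt_mult; auto.
Qed.

Lemma continuous_density_dissipation :
  continuous_at_positive_times (fun x t => Derive_n P 2 (m x t) * d_x m x t ^ 2).
Proof.
  intros x t Ht; apply continuity_2d_pt_mult.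
  - apply continuity_1d_2d_pt_comp; [|auto].
    apply (C_class_continuity_pt 2 2 pos_half_line); auto;
      [apply (sol_P sol)|apply mpos, Ht].
  - apply continuity_2d_pt_ext with (fun y s => d_x m y s * d_x m y s); [intros; ring|].
    apply continuity_2d_pt_mult; auto.
Qed.

Lemma continuous_entropy_production :
  continuous_at_positive_times
    (fun x t => Derive H (v x t) * d_t v x t + Derive P (m x t) * d_t m x t).
Proof.
  intros x t Ht; apply continuity_2d_pt_plus; apply continuity_2d_pt_mult; auto.
  - apply continuity_2d_pt_comp_derivable with (Derive_n H 2 (v x t)); auto.
  - apply continuity_2d_pt_comp_derivable with (Derive_n P 2 (m x t)); auto.
Qed.

(** The identity [m P'' = g'] makes [m P'(m) H'(v)] an entropy flux: the mixed
    terms [P' H' m_x + m P' H'' v_x + H' g' m_x] are its exact [x]-derivative.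
    The remaining transport term [H'(v)^2 v_x] is a derivative as well, and the
    viscous terms leave the dissipation after one integration by parts. *)
Lemma entropy_production_identity (t : R) : 0 < t ->
  torus_int (fun x => Derive H (v x t) * d_t v x t + Derive P (m x t) * d_t m x t)
    = - eps * dissipation t.
Proof.
  intros Ht.
  set (F := fun s => RInt (fun r => Derive H r ^ 2) 0 s).
  assert (dF : forall s, is_derive F s (Derive H s ^ 2)).
  { intros s; apply (is_derive_primitive (fun r => Derive H r ^ 2)); intros r.
    apply (ex_derive_continuous (fun r => Derive H r ^ 2)).
    eexists; apply (is_derive_pow (Derive H) 2); apply ddH. }
  assert (cD : forall x, continuous (fun y => dissipation_density y t) x).
  { apply (positive_times_slice dissipation_density); [|exact Ht].
    intros x s Hs; apply continuity_2d_pt_plus.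
    - apply continuous_velocity_dissipation, Hs.
    - apply continuous_density_dissipation, Hs. }
  assert (cE := positive_times_slice _ t continuous_entropy_production Ht).
  assert (Hz : torus_int (fun x => eps * dissipation_density x t
     + (Derive H (v x t) * d_t v x t + Derive P (m x t) * d_t m x t)) = 0).
  { apply (torus_int_derive (fun x =>
      eps * (Derive H (v x t) * d_x v x t + Derive P (m x t) * d_x m x t)
      + (m x t * Derive P (m x t) * Derive H (v x t) - F (v x t)))).
    - intros x; eapply is_derive_eq.
      { apply is_derive_sum.
        - apply is_derive_const_mult, is_derive_sum.
          + apply (is_derive_product (fun y => Derive H (v y t)) (fun y => d_x v y t)); auto.
            apply (is_derive_chain (Derive H) (fun y => v y t)); auto.
          + apply (is_derive_product (fun y => Derive P (m y t)) (fun y => d_x m y t)); auto.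
            apply (is_derive_chain (Derive P) (fun y => m y t)); auto.
        - apply is_derive_difference.
          + apply (is_derive_product (fun y => m y t * Derive P (m y t))
                     (fun y => Derive H (v y t))).
            * apply (is_derive_product (fun y => m y t) (fun y => Derive P (m y t))); auto.
              apply (is_derive_chain (Derive P) (fun y => m y t)); auto.
            * apply (is_derive_chain (Derive H) (fun y => v y t)); auto.
          + apply (is_derive_chain F (fun y => v y t)); auto. }
      unfold dissipation_density.
      rewrite (velocity_equation x t Ht), (density_equation x t Ht).
      rewrite (sol_P2 sol (m x t) (mpos x t Ht)).
      field; apply Rgt_not_eq, mpos, Ht.
    - intros x; apply (continuous_plus (fun y => eps * dissipation_density y t)).
      + apply (continuous_scal_r (K := R_AbsRing) (V := R_NormedModule) eps), cD.
      + apply cE.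
    - rewrite (regular_periodic_dx v (sol_v sol)),
        (regular_periodic_dx m (sol_m sol)),
        (regular_periodic v (sol_v sol)),
        (regular_periodic m (sol_m sol)) by exact Ht; reflexivity. }
  rewrite torus_int_plus, torus_int_scal in Hz; [|exact cD| |exact cE].
  - unfold dissipation; lra.
  - intros x; apply (continuous_scal_r (K := R_AbsRing) (V := R_NormedModule) eps), cD.
Qed.

Lemma continuous_entropy_densities :
  continuous_at_positive_times (fun x t => H (v x t)) /\
  continuous_at_positive_times (fun x t => P (m x t)).
Proof.
  split; intros x t Ht.
  - apply continuity_2d_pt_comp_derivable with (Derive H (v x t)); auto.
  - apply continuity_2d_pt_comp_derivable with (Derive P (m x t)); auto.
Qed.

Lemma is_derive_entropy (t : R) :
  0 < t -> is_derive entropy t (- eps * dissipation t).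
Proof.
  intros Ht; rewrite <- entropy_production_identity by exact Ht.
  apply (is_derive_torus_int (fun x s => H (v x s) + P (m x s))
    (fun x s => Derive H (v x s) * d_t v x s + Derive P (m x s) * d_t m x s)); auto.
  - intros x s Hs; apply continuity_2d_pt_plus; apply continuous_entropy_densities, Hs.
  - apply continuous_entropy_production.
  - intros x s Hs; apply is_derive_sum.
    + apply (is_derive_chain H (fun r => v x r)); auto.
    + apply (is_derive_chain P (fun r => m x r)); auto.
Qed.

End Solution.

(** * From small dissipation to small relative entropy *)

Lemma continuous_relative_entropy (Phi : R -> R) (c : R) (w : R -> R) (x : R) :
  ex_derive Phi (w x) -> continuous w x ->
  continuous (fun y => relative_entropy Phi c (w y)) x.
Proof.
  intros HPhi Hw; apply (continuous_comp w (relative_entropy Phi c)); [exact Hw|].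
  apply (ex_derive_continuous (V := R_NormedModule)); eexists.
  apply is_derive_relative_entropy, HPhi.
Qed.

Lemma C_class_ex_derive (n : nat) (I : R -> Prop) (f : R -> R) (s : R) :
  C_class n I f -> (1 <= n)%nat -> I s -> ex_derive f s.
Proof. intros Hf Hn Is; apply (Hf 1%nat Hn s Is). Qed.

Lemma strictly_increasing_C2_derive (I : R -> Prop) (Phi : R -> R) :
  order_convex I -> C_class 2 I Phi -> nonneg_nowhere_flat I (Derive_n Phi 2) ->
  strictly_increasing_on I (Derive Phi).
Proof.
  intros HI HC Hflat; apply (strictly_increasing_of_derive I _ (Derive_n Phi 2)); auto.
  intros s Is; apply (C_class_is_derive 2 1 I Phi s HC); auto.
Qed.

(** The derivative of [Psi (w x)] has square [Phi''(w) w'^2], so small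
    dissipation bounds the oscillation of [Psi (w x)].  As [w] attains its mean
    [c], the value [Psi (w x)] is everywhere close to [Psi c], and strict
    monotonicity of [Psi] turns this into uniform closeness of [w] to [c]. *)
Lemma small_dissipation_small_relative_entropy
    (I : R -> Prop) (Phi Psi : R -> R) (c eta0 kappa : R) :
  order_convex I -> C_class 2 I Phi -> nonneg_nowhere_flat I (Derive_n Phi 2) ->
  sqrt_second_primitive I Phi Psi ->
  0 < eta0 -> I (c - eta0) -> I c -> I (c + eta0) -> 0 < kappa ->
  exists delta, 0 < delta /\
    forall w dw : R -> R,
      (forall x, I (w x)) -> (forall x, is_derive w x (dw x)) ->
      (forall x, continuous dw x) -> torus_int w = c ->
      torus_int (fun x => Derive_n Phi 2 (w x) * dw x ^ 2) <= delta ->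
      torus_int (fun x => relative_entropy Phi c (w x)) <= kappa.
Proof.
  intros HI HC Hflat [HPC HPsi] Heta0 Il Ic Ir Hk.
  assert (Hexd : forall s, I s -> ex_derive Phi s)
    by (intros s Is; apply (C_class_ex_derive 2 I); auto).
  assert (HdPsi : forall s, I s -> is_derive Psi s (Derive Psi s))
    by (intros s Is; apply (C_class_is_derive 1 0 I Psi s HPC); auto).
  destruct (relative_entropy_small_near Phi c kappa (Hexd c Ic) Hk) as [eta1 [He1 Hnear]].
  set (eta := Rmin eta0 eta1).
  assert (Heta : 0 < eta) by (apply Rmin_pos; auto).
  assert (eta <= eta0) by apply Rmin_l.
  assert (eta <= eta1) by apply Rmin_r.
  assert (Hinc : strictly_increasing_on I Psi).
  { apply (strictly_increasing_of_derive I Psi (Derive Psi)); auto.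
    apply (nonneg_nowhere_flat_sqrt I (Derive_n Phi 2)); auto. }
  destruct (strictly_increasing_close_preimage I Psi c eta Hinc Heta) as [lam [Hlam Hpre]].
  { apply (HI (c - eta0) (c + eta0)); auto; lra. }
  { exact Ic. }
  { apply (HI (c - eta0) (c + eta0)); auto; lra. }
  exists (lam ^ 2); split; [apply pow_lt, Hlam|].
  intros w dw Iw Hw Hdw Hmean Hint.
  assert (Hcw : forall x, continuous w x)
    by (intros x; apply (ex_derive_continuous (V := R_NormedModule)); eexists; apply Hw).
  destruct (torus_mean_attained w Hcw) as [x0 [Hx0 Hwx0]].
  rewrite Hmean in Hwx0.
  assert (Hosc : forall x, 0 <= x <= 1 -> Rabs (Psi (w x) - Psi c) <= lam).
  { intros x Hx; rewrite <- Hwx0.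
    apply (torus_oscillation (fun y => Psi (w y)) (fun y => Derive Psi (w y) * dw y));
      auto.
    - intros s; apply (is_derive_chain Psi w); auto.
    - intros s; apply (continuous_mult (fun y => Derive Psi (w y)) dw); auto.
      apply (continuous_comp w (Derive Psi)); [apply Hcw|].
      apply (HPC 1%nat ltac:(auto) (w s) (Iw s)).
    - rewrite (torus_int_ext _ (fun x => Derive_n Phi 2 (w x) * dw x ^ 2)); [exact Hint|].
      intros s; rewrite Rpow_mult_distr, HPsi by apply Iw.
      rewrite pow2_sqrt; [reflexivity|apply Hflat, Iw]. }
  rewrite <- (torus_int_const kappa); apply torus_int_le.
  - intros x; apply continuous_relative_entropy; auto.
  - intros; apply continuous_const.
  - intros x Hx; apply Hnear.
    apply Rlt_le_trans with eta; [|assumption]; apply Hpre; auto.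
Qed.

Lemma relative_entropy_controls_L1 (I : R -> Prop) (Phi : R -> R) (c eta0 e : R) :
  order_convex I -> C_class 2 I Phi -> nonneg_nowhere_flat I (Derive_n Phi 2) ->
  0 < eta0 -> I (c - eta0) -> I c -> I (c + eta0) -> 0 < e ->
  exists kappa, 0 < kappa /\
    forall w : R -> R, (forall x, I (w x)) -> (forall x, continuous w x) ->
      torus_int (fun x => relative_entropy Phi c (w x)) <= kappa ->
      torus_int (fun x => Rabs (w x - c)) <= e.
Proof.
  intros HI HC Hflat Heta0 Il Ic Ir He.
  assert (Hexd : forall s, I s -> ex_derive Phi s)
    by (intros s Is; apply (C_class_ex_derive 2 I); auto).
  set (eta := Rmin eta0 (e / 2)).
  assert (Heta : 0 < eta) by (apply Rmin_pos; lra).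
  assert (eta <= eta0) by apply Rmin_l.
  assert (eta <= e / 2) by apply Rmin_r.
  destruct (relative_entropy_coercive I Phi c eta) as [K [HK Hco]]; auto.
  { apply strictly_increasing_C2_derive; auto. }
  { apply (HI (c - eta0) (c + eta0)); auto; lra. }
  { apply (HI (c - eta0) (c + eta0)); auto; lra. }
  exists (/ K * (e / 2)); split.
  { apply Rmult_lt_0_compat; [apply Rinv_0_lt_compat|]; lra. }
  intros w Iw Hw Hrel.
  assert (Hcr : forall x, continuous (fun y => relative_entropy Phi c (w y)) x)
    by (intros; apply continuous_relative_entropy; auto).
  assert (HcK : forall x, continuous (fun y => K * relative_entropy Phi c (w y)) x)
    by (intros x; apply (continuous_scal_r (K := R_AbsRing) (V := R_NormedModule) K), Hcr).
  assert (Hce : forall x : R, continuous (fun _ : R => eta) x)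
    by (intros; apply continuous_const).
  apply Rle_trans with (torus_int (fun x => eta + K * relative_entropy Phi c (w x))).
  - apply torus_int_le; [| |intros x _; apply Hco, Iw].
    + intros x; apply (continuous_comp (fun y => w y - c) Rabs); [|apply continuous_Rabs].
      apply (continuous_minus w); [apply Hw|apply continuous_const].
    + intros x; apply (continuous_plus (fun _ => eta)); auto.
  - rewrite torus_int_plus, torus_int_const, torus_int_scal by assumption.
    apply (Rmult_le_compat_l K) in Hrel; [|lra].
    rewrite <- Rmult_assoc, Rinv_r in Hrel by lra; lra.
Qed.

(** * Long-time limits *)

Lemma is_lim_p_infty_zero (f : R -> R) :
  (forall e, 0 < e -> exists T, forall t, T <= t -> 0 <= f t <= e) ->
  is_lim f p_infty 0.
Proof.
  intros Hf; apply is_lim_spec; intros e.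
  destruct (Hf (e / 2)) as [T HT]; [destruct e; simpl; lra|].
  exists T; intros t Ht; specialize (HT t ltac:(lra)).
  rewrite Rminus_0_r, Rabs_right by lra; destruct e; simpl in *; lra.
Qed.

Lemma is_lim_p_infty_zero_inv (f : R -> R) :
  is_lim f p_infty 0 ->
  forall e, 0 < e -> exists T, 0 < T /\ forall t, T <= t -> Rabs (f t) <= e.
Proof.
  intros Hf e He; apply is_lim_spec in Hf.
  destruct (Hf (mkposreal e He)) as [M HM].
  exists (Rmax M 0 + 1); pose proof (Rmax_l M 0); pose proof (Rmax_r M 0).
  split; [lra|]; intros t Ht.
  specialize (HM t ltac:(lra)); rewrite Rminus_0_r in HM; simpl in HM; lra.
Qed.

Section Decay.
Context (eps : R) (H g P PsiH PsiP : R -> R) (v m : R -> R -> R).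
Context (Heps : 0 < eps) (sol : system_solution eps H g P v m).
Context (Hflat : nonneg_nowhere_flat whole_line (Derive_n H 2)).
Context (Pflat : nonneg_nowhere_flat pos_half_line (Derive_n P 2)).
Context (HPsiH : sqrt_second_primitive whole_line H PsiH).
Context (HPsiP : sqrt_second_primitive pos_half_line P PsiP).
Context (v_mean : torus_int (fun x => v x 0) = 0).
Context (m_mean : torus_int (fun x => m x 0) = 1).

Definition velocity_entropy (t : R) : R :=
  torus_int (fun x => relative_entropy H 0 (v x t)).
Definition density_entropy (t : R) : R :=
  torus_int (fun x => relative_entropy P 1 (m x t)).

Let cv := regular_continuous v (sol_v sol).
Let cm := regular_continuous m (sol_m sol).
Let mpos := sol_m_pos sol.
Let exH (s : R) : ex_derive H s :=
  C_class_ex_derive 2 whole_line H s (sol_H sol) ltac:(auto) I.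
Let exP (s : R) (Hs : 0 < s) : ex_derive P s :=
  C_class_ex_derive 2 pos_half_line P s (sol_P sol) ltac:(auto) Hs.

Lemma velocity_entropy_nonneg (t : R) : 0 < t -> 0 <= velocity_entropy t.
Proof.
  intros Ht; apply torus_int_nonneg.
  - intros x; apply continuous_relative_entropy; [apply exH|].
    apply positive_times_slice; auto.
  - intros x; apply (relative_entropy_nonneg whole_line); try exact I.
    + apply order_convex_whole_line.
    + intros; apply exH.
    + apply strictly_increasing_C2_derive; auto using order_convex_whole_line.
      apply (sol_H sol).
Qed.

Lemma density_entropy_nonneg (t : R) : 0 < t -> 0 <= density_entropy t.
Proof.
  intros Ht; apply torus_int_nonneg.
  - intros x; apply continuous_relative_entropy; [apply exP, mpos, Ht|].
    apply positive_times_slice; auto.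
  - intros x; apply (relative_entropy_nonneg pos_half_line).
    + apply order_convex_pos_half_line.
    + intros; apply exP; assumption.
    + apply strictly_increasing_C2_derive; auto using order_convex_pos_half_line.
      apply (sol_P sol).
    + unfold pos_half_line; lra.
    + apply mpos, Ht.
Qed.

(** The affine corrections integrate to zero because the means of [v] and [m]
    stay equal to [0] and [1]. *)
Lemma entropy_decomposition (t : R) : 0 < t ->
  entropy H P v m t = H 0 + P 1 + (velocity_entropy t + density_entropy t).
Proof.
  intros Ht; unfold entropy, velocity_entropy, density_entropy.
  assert (Hv := velocity_mean_conserved eps H g P v m sol t Ht).
  assert (Hm := density_mean_conserved eps H g P v m sol t Ht).
  rewrite v_mean in Hv; rewrite m_mean in Hm.
  assert (sv := positive_times_slice v t cv Ht).
  assert (sm := positive_times_slice m t cm Ht).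
  assert (rv : forall x, continuous (fun y => relative_entropy H 0 (v y t)) x)
    by (intros x; apply continuous_relative_entropy; [apply exH|apply sv]).
  assert (rm : forall x, continuous (fun y => relative_entropy P 1 (m y t)) x)
    by (intros x; apply continuous_relative_entropy; [apply exP, mpos, Ht|apply sm]).
  assert (lin : forall a (w : R -> R), (forall x, continuous w x) ->
            forall x, continuous (fun y => a * w y) x).
  { intros a w Hw x; apply (continuous_scal_r (K := R_AbsRing) (V := R_NormedModule) a), Hw. }
  assert (add : forall w z : R -> R, (forall x, continuous w x) ->
            (forall x, continuous z x) -> forall x, continuous (fun y => w y + z y) x).
  { intros w z Hw Hz x; apply (continuous_plus w z); auto. }
  assert (cst : forall a x : R, continuous (fun _ : R => a) x)
    by (intros; apply continuous_const).
  rewrite (torus_int_ext _ (fun x => (H 0 + P 1 - Derive P 1)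
    + ((Derive H 0 * v x t + Derive P 1 * m x t)
       + (relative_entropy H 0 (v x t) + relative_entropy P 1 (m x t))))).
  2: { intros x; unfold relative_entropy; ring. }
  rewrite !torus_int_plus, !torus_int_scal, torus_int_const, Hv, Hm by auto 7; ring.
Qed.

Lemma dissipation_density_nonneg (t x : R) : 0 < t -> 0 <= dissipation_density H P v m x t.
Proof.
  intros Ht; apply Rplus_le_le_0_compat; apply Rmult_le_pos; try apply pow2_ge_0.
  - apply Hflat, I.
  - apply Pflat, mpos, Ht.
Qed.

Lemma dissipation_bounds_parts (t : R) : 0 < t ->
  torus_int (fun x => Derive_n H 2 (v x t) * d_x v x t ^ 2) <= dissipation H P v m t /\
  torus_int (fun x => Derive_n P 2 (m x t) * d_x m x t ^ 2) <= dissipation H P v m t.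
Proof.
  intros Ht.
  assert (c1 := positive_times_slice _ t
                  (continuous_velocity_dissipation eps H g P v m sol) Ht).
  assert (c2 := positive_times_slice _ t
                  (continuous_density_dissipation eps H g P v m sol) Ht).
  assert (p1 : forall x, 0 <= Derive_n H 2 (v x t) * d_x v x t ^ 2)
    by (intros; apply Rmult_le_pos; [apply Hflat, I|apply pow2_ge_0]).
  assert (p2 : forall x, 0 <= Derive_n P 2 (m x t) * d_x m x t ^ 2)
    by (intros; apply Rmult_le_pos; [apply Pflat, mpos, Ht|apply pow2_ge_0]).
  unfold dissipation, dissipation_density; rewrite torus_int_plus by assumption.
  assert (i1 : 0 <= torus_int (fun x => Derive_n H 2 (v x t) * d_x v x t ^ 2))
    by (apply torus_int_nonneg; assumption).
  assert (i2 : 0 <= torus_int (fun x => Derive_n P 2 (m x t) * d_x m x t ^ 2))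
    by (apply torus_int_nonneg; assumption).
  split; lra.
Qed.

Lemma dissipation_nonneg (t : R) : 0 < t -> 0 <= dissipation H P v m t.
Proof.
  intros Ht; apply torus_int_nonneg; [|intros; apply dissipation_density_nonneg, Ht].
  apply (positive_times_slice (dissipation_density H P v m)); [|exact Ht].
  intros x s Hs; apply continuity_2d_pt_plus.
  - apply (continuous_velocity_dissipation eps H g P v m sol), Hs.
  - apply (continuous_density_dissipation eps H g P v m sol), Hs.
Qed.

Lemma entropy_nonincreasing (s t : R) :
  0 < s -> s <= t -> entropy H P v m t <= entropy H P v m s.
Proof.
  intros Hs Hst.
  destruct (MVT_on pos_half_line (entropy H P v m)
    (fun r => - eps * dissipation H P v m r) s t order_convex_pos_half_line)
    as [c [_ [Hc Heq]]]; [|exact Hs|unfold pos_half_line; lra|exact Hst|].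
  - intros r Hr; apply (is_derive_entropy eps H g P v m sol), Hr.
  - pose proof (dissipation_nonneg c Hc).
    assert (0 <= eps * dissipation H P v m c * (t - s)).
    { apply Rmult_le_pos; [apply Rmult_le_pos|]; lra. }
    lra.
Qed.

(** Otherwise the entropy would decrease at a rate of at least [eps * delta]
    forever, against its lower bound [H 0 + P 1]. *)
Lemma dissipation_small_sometime (delta : R) :
  0 < delta -> exists t, 0 < t /\ dissipation H P v m t <= delta.
Proof.
  intros Hdelta; apply NNPP; intros Hno.
  assert (Hlarge : forall t, 0 < t -> delta < dissipation H P v m t).
  { intros t Ht; apply Rnot_le_lt; intros Hle; apply Hno; exists t; auto. }
  set (gap := entropy H P v m 1 - (H 0 + P 1)).
  assert (Hlow : forall t, 0 < t -> H 0 + P 1 <= entropy H P v m t).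
  { intros t Ht; rewrite entropy_decomposition by exact Ht.
    pose proof (velocity_entropy_nonneg t Ht); pose proof (density_entropy_nonneg t Ht); lra. }
  assert (Hgap : 0 <= gap) by (unfold gap; specialize (Hlow 1 ltac:(lra)); lra).
  assert (Hr : 0 < eps * delta) by (apply Rmult_lt_0_compat; auto).
  set (T := 1 + (gap + 1) / (eps * delta)).
  assert (HT : eps * delta * (T - 1) = gap + 1) by (unfold T; field; lra).
  assert (HT1 : 1 <= T).
  { unfold T; assert (0 < (gap + 1) / (eps * delta)) by (apply Rdiv_lt_0_compat; lra); lra. }
  destruct (MVT_on pos_half_line (entropy H P v m)
    (fun r => - eps * dissipation H P v m r) 1 T order_convex_pos_half_line)
    as [c [_ [Hc Heq]]]; [|unfold pos_half_line; lra|unfold pos_half_line; lra|exact HT1|].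
  - intros r Hr'; apply (is_derive_entropy eps H g P v m sol), Hr'.
  - specialize (Hlow T ltac:(lra)); specialize (Hlarge c Hc).
    assert (eps * delta * (T - 1) <= eps * dissipation H P v m c * (T - 1)).
    { apply Rmult_le_compat_r; [lra|]; apply Rmult_le_compat_l; lra. }
    unfold gap in *; lra.
Qed.

(** Smallness at one time, given by small dissipation, persists because the sum of
    the two relative entropies is nonincreasing. *)
Lemma relative_entropies_vanish (kappa : R) : 0 < kappa ->
  exists T, 0 < T /\ forall t, T <= t ->
    velocity_entropy t <= kappa /\ density_entropy t <= kappa.
Proof.
  intros Hk.
  destruct (small_dissipation_small_relative_entropy whole_line H PsiH 0 1 (kappa / 2))
    as [d1 [Hd1 S1]]; auto using order_convex_whole_line; try exact I; try lra.
  { apply (sol_H sol). }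
  destruct (small_dissipation_small_relative_entropy pos_half_line P PsiP 1 (1 / 2)
    (kappa / 2)) as [d2 [Hd2 S2]]; auto using order_convex_pos_half_line;
    unfold pos_half_line; try lra.
  { apply (sol_P sol). }
  destruct (dissipation_small_sometime (Rmin d1 d2)) as [T [HT Hdis]].
  { apply Rmin_pos; assumption. }
  pose proof (Rmin_l d1 d2); pose proof (Rmin_r d1 d2).
  destruct (dissipation_bounds_parts T HT) as [B1 B2].
  assert (E1 : velocity_entropy T <= kappa / 2).
  { apply (S1 (fun x => v x T) (fun x => d_x v x T)).
    - intros; exact I.
    - intros; apply regular_is_derive_x; [apply (sol_v sol)|exact HT].
    - apply positive_times_slice; [|exact HT].
      apply regular_continuous_dx, (sol_v sol).
    - rewrite (velocity_mean_conserved eps H g P v m sol T HT); exact v_mean.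
    - lra. }
  assert (E2 : density_entropy T <= kappa / 2).
  { apply (S2 (fun x => m x T) (fun x => d_x m x T)).
    - intros; apply mpos, HT.
    - intros; apply regular_is_derive_x; [apply (sol_m sol)|exact HT].
    - apply positive_times_slice; [|exact HT].
      apply regular_continuous_dx, (sol_m sol).
    - rewrite (density_mean_conserved eps H g P v m sol T HT); exact m_mean.
    - lra. }
  exists T; split; [exact HT|]; intros t Ht.
  assert (Ht0 : 0 < t) by lra.
  assert (Hmon := entropy_nonincreasing T t HT Ht).
  rewrite !entropy_decomposition in Hmon by assumption.
  pose proof (velocity_entropy_nonneg t Ht0); pose proof (density_entropy_nonneg t Ht0).
  lra.
Qed.

Lemma velocity_L1_limit :
  is_lim (fun t => torus_int (fun x => Rabs (v x t))) p_infty 0.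
Proof.
  apply is_lim_p_infty_zero; intros e He.
  destruct (relative_entropy_controls_L1 whole_line H 0 1 e) as [k [Hk Hctl]];
    auto using order_convex_whole_line; try exact I; try lra.
  { apply (sol_H sol). }
  destruct (relative_entropies_vanish k Hk) as [T [HT HTt]].
  exists T; intros t Ht.
  assert (sv := positive_times_slice v t cv ltac:(lra)).
  split.
  - apply torus_int_nonneg; [|intros; apply Rabs_pos].
    intros x; apply (continuous_comp (fun y => v y t) Rabs); [apply sv|apply continuous_Rabs].
  - rewrite (torus_int_ext _ (fun x => Rabs (v x t - 0)))
      by (intros; now rewrite Rminus_0_r).
    apply (Hctl (fun x => v x t)); [intros; exact I|exact sv|].
    exact (proj1 (HTt t Ht)).
Qed.

Lemma density_L1_limit :
  is_lim (fun t => torus_int (fun x => Rabs (m x t - 1))) p_infty 0.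
Proof.
  apply is_lim_p_infty_zero; intros e He.
  destruct (relative_entropy_controls_L1 pos_half_line P 1 (1 / 2) e) as [k [Hk Hctl]];
    auto using order_convex_pos_half_line; unfold pos_half_line; try lra.
  { apply (sol_P sol). }
  destruct (relative_entropies_vanish k Hk) as [T [HT HTt]].
  exists T; intros t Ht.
  assert (sm := positive_times_slice m t cm ltac:(lra)).
  split.
  - apply torus_int_nonneg; [|intros; apply Rabs_pos].
    intros x; apply (continuous_comp (fun y => m y t - 1) Rabs); [|apply continuous_Rabs].
    apply (continuous_minus (fun y => m y t)); [apply sm|apply continuous_const].
  - apply (Hctl (fun x => m x t)); [intros; apply mpos; lra|exact sm|].
    exact (proj2 (HTt t Ht)).
Qed.

End Decay.

(** * Interpolation between L^1 and uniform bounds *)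

Lemma abs_power_nonneg (y p : R) : 0 <= abs_power y p.
Proof.
  unfold abs_power; destruct (Req_EM_T y 0); [lra|left; apply exp_pos].
Qed.

Lemma abs_power_le_linear (y p M : R) :
  1 < p -> Rabs y <= M -> abs_power y p <= Rpower M (p - 1) * Rabs y.
Proof.
  intros Hp Hy; unfold abs_power; destruct (Req_EM_T y 0) as [->|Hne].
  - rewrite Rabs_R0; lra.
  - assert (Hpos : 0 < Rabs y) by (apply Rabs_pos_lt, Hne).
    replace (Rpower (Rabs y) p) with (Rpower (Rabs y) (p - 1) * Rabs y).
    + apply Rmult_le_compat_r; [lra|apply Rle_Rpower_l; lra].
    + rewrite <- (Rpower_1 (Rabs y)) at 2 by exact Hpos.
      rewrite <- Rpower_plus; f_equal; ring.
Qed.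

Lemma continuous_abs_power (p y : R) : 1 < p -> continuous (fun z => abs_power z p) y.
Proof.
  intros Hp; destruct (Req_dec y 0) as [->|Hne].
  - (* Near 0 the function is squeezed by the absolute value. *)
    apply continuity_pt_filterlim, continuity_pt_locally; intros e.
    assert (Hd : 0 < Rmin 1 e) by (apply Rmin_pos; [lra|apply cond_pos]).
    exists (mkposreal _ Hd); intros z Hz.
    assert (Hz' : Rabs (z - 0) < Rmin 1 e) by exact Hz.
    rewrite Rminus_0_r in Hz'.
    pose proof (Rmin_l 1 e); pose proof (Rmin_r 1 e).
    assert (Hle := abs_power_le_linear z p 1 Hp ltac:(lra)).
    replace (Rpower 1 (p - 1)) with 1 in Hle
      by (unfold Rpower; rewrite ln_1, Rmult_0_r, exp_0; reflexivity).
    unfold abs_power at 2; destruct (Req_EM_T 0 0) as [_|Hc]; [|now contradiction Hc].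
    rewrite Rminus_0_r, Rabs_right by (apply Rle_ge, abs_power_nonneg); lra.
  - apply (continuous_ext_loc _ (fun z => Rpower (Rabs z) p)).
    + assert (Hy : 0 < Rabs y) by (apply Rabs_pos_lt, Hne).
      exists (mkposreal _ Hy); intros z Hz.
      assert (Hz' : Rabs (z - y) < Rabs y) by exact Hz.
      unfold abs_power; destruct (Req_EM_T z 0) as [->|_]; [|reflexivity].
      rewrite Rminus_0_l, Rabs_Ropp in Hz'; lra.
    + apply (continuous_comp Rabs (fun r => Rpower r p)); [apply continuous_Rabs|].
      apply (ex_derive_continuous (V := R_NormedModule)); unfold Rpower; auto_derive.
      apply Rabs_pos_lt, Hne.
Qed.

Lemma bounded_L1_limit_Lp_limit (w : R -> R -> R) (M p : R) :
  1 < p -> (forall t, 0 < t -> forall x, continuous (fun y => w y t) x) ->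
  (forall x t, 0 < t -> Rabs (w x t) <= M) ->
  is_lim (fun t => torus_int (fun x => Rabs (w x t))) p_infty 0 ->
  is_lim (fun t => torus_int (fun x => abs_power (w x t) p)) p_infty 0.
Proof.
  intros Hp Hc HM Hlim; apply is_lim_p_infty_zero; intros e He.
  set (A := Rpower M (p - 1)).
  assert (HA : 0 < A) by apply exp_pos.
  destruct (is_lim_p_infty_zero_inv _ Hlim (/ A * e)) as [T [HT HTt]].
  { apply Rmult_lt_0_compat; [apply Rinv_0_lt_compat|]; assumption. }
  exists T; intros t Ht; assert (Ht0 : 0 < t) by lra.
  assert (cp : forall x, continuous (fun y => abs_power (w y t) p) x).
  { intros x; apply (continuous_comp (fun y => w y t) (fun z => abs_power z p));
      [apply Hc, Ht0|apply continuous_abs_power, Hp]. }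
  assert (ca : forall x, continuous (fun y => Rabs (w y t)) x).
  { intros x; apply (continuous_comp (fun y => w y t) Rabs);
      [apply Hc, Ht0|apply continuous_Rabs]. }
  split; [apply torus_int_nonneg; [exact cp|intros; apply abs_power_nonneg]|].
  apply Rle_trans with (torus_int (fun x => A * Rabs (w x t))).
  - apply torus_int_le; [exact cp| |intros; apply abs_power_le_linear; auto].
    intros x; apply (continuous_scal_r (K := R_AbsRing) (V := R_NormedModule) A), ca.
  - rewrite torus_int_scal by exact ca.
    specialize (HTt t Ht); pose proof (Rle_abs (torus_int (fun x => Rabs (w x t)))).
    assert (Hle : torus_int (fun x => Rabs (w x t)) <= / A * e) by lra.
    apply (Rmult_le_compat_l A) in Hle; [|lra].
    rewrite <- Rmult_assoc, Rinv_r in Hle by lra; lra.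
Qed.

Lemma uniformly_bounded_pointwise (u : R -> R -> R) :
  uniformly_bounded_in_time u ->
  exists M, forall x t, 0 <= t -> Rabs (u x t) <= M.
Proof.
  intros [M HM]; exists M; intros x t Ht.
  apply (Rbar_le_trans (Rabs (u x t)) (sup_norm (fun y => u y t)) M); [|apply HM, Ht].
  apply (proj1 (Lub_Rbar_correct (fun r => exists y, r = Rabs (u y t)))).
  exists x; reflexivity.
Qed.

Theorem theorem4p9 :
  forall (eps : R) (H g P PsiH PsiP : R -> R) (v m : R -> R -> R),
    0 < eps ->
    C_class 2 whole_line H ->
    strictly_convex_on whole_line H ->
    C_class 1 pos_half_line g ->
    strictly_increasing_on pos_half_line g ->
    C_class 2 pos_half_line P ->
    (forall s : R, 0 < s -> Derive_n P 2 s = Derive g s / s) ->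
    sqrt_second_primitive whole_line H PsiH ->
    sqrt_second_primitive pos_half_line P PsiP ->
    Rbar_lt (convexity_const whole_line H PsiH) p_infty ->
    Rbar_lt (convexity_const pos_half_line P PsiP) p_infty ->
    classical_regularity v ->
    classical_regularity m ->
    (forall x t : R, 0 < t -> 0 < m x t) ->
    solves_system eps H g v m ->
    torus_int (fun x => v x 0) = 0 ->
    torus_int (fun x => m x 0) = 1 ->
    (is_lim (fun t => torus_int (fun x => Rabs (v x t))) p_infty 0 /\
     is_lim (fun t => torus_int (fun x => Rabs (m x t - 1))) p_infty 0) /\
    (uniformly_bounded_in_time v ->
     uniformly_bounded_in_time m ->
     forall p : R, 1 < p ->
       is_lim (fun t => torus_int (fun x => abs_power (v x t) p)) p_infty 0 /\
       is_lim (fun t => torus_int (fun x => abs_power (m x t - 1) p)) p_infty 0).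
Proof.
  intros eps H g P PsiH PsiP v m Heps HH HHc Hg Hgi HP HP2 HPsiH HPsiP _ _
    Hv Hm Hmpos Hsys Hv0 Hm0.
  assert (sol : system_solution eps H g P v m) by (constructor; assumption).
  assert (Hflat := strictly_convex_second_derive H HH HHc).
  assert (Pflat := strictly_increasing_derive_quotient g (Derive_n P 2) Hg Hgi HP2).
  assert (Lv : is_lim (fun t => torus_int (fun x => Rabs (v x t))) p_infty 0)
    by (eapply velocity_L1_limit; eauto).
  assert (Lm : is_lim (fun t => torus_int (fun x => Rabs (m x t - 1))) p_infty 0)
    by (eapply density_L1_limit; eauto).
  split; [split; assumption|]; intros Bv Bm p Hp.
  destruct (uniformly_bounded_pointwise v Bv) as [Mv HMv].
  destruct (uniformly_bounded_pointwise m Bm) as [Mm HMm].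
  split.
  - apply (bounded_L1_limit_Lp_limit v Mv); auto.
    + intros t Ht; apply positive_times_slice; [apply regular_continuous, Hv|exact Ht].
    + intros x t Ht; apply HMv; lra.
  - apply (bounded_L1_limit_Lp_limit (fun x t => m x t - 1) (Mm + 1)); auto.
    + intros t Ht x; apply (continuous_minus (fun y => m y t)).
      * apply positive_times_slice; [apply regular_continuous, Hm|exact Ht].
      * apply continuous_const.
    + intros x t Ht; specialize (HMm x t ltac:(lra)).
      apply Rle_trans with (Rabs (m x t) + Rabs (- (1))); [apply Rabs_triang|].
      rewrite Rabs_Ropp, Rabs_R1; lra.
Qed.
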